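(* Let $n,q\ge 1$ be integers. If a Butson Hadamard matrix $BH(n,q)$ exists, then there exists a function $g\colon\Omega_q^n\to\mathbb{R}$ such that: (i) $g\ge 0$; (ii) $g(e_a)=1/q$ for every $a\in\Omega_q$, where $e_a=[a,a,\dots,a]\in\Omega_q^n$; (iii) $g$ is supported on $ORT\cup\{e_a\colon a\in\Omega_q\}$, i.e. $g(x)=0$ for all other $x$; (iv) $g$ is constant on each $\cong$-equivalence class of $\Omega_q^n$; (v) $\sum_{x\in\Omega_q^n}g(x)=n$; (vi) $\widehat{g}(z)\ge 0$ for all $z\in\mathbb{Z}_q^n$.
   Context: A Butson Hadamard matrix $BH(n,q)$ is an $n\times n$ complex matrix all of whose entries are $q$th roots of unity and whose rows are pairwise orthogonal with respect to the standard complex inner product on $\mathbb{C}^n$. Let $\zeta_q=\exp(2\pi\mathbf{i}/q)$ and $\Omega_q=\{1,\zeta_q,\dots,\zeta_q^{q-1}\}$; $\Omega_q^n$ is a group under coordinate-wise multiplication, elements viewed as row vectors. The orthogonality set is $ORT=\{x\in\Omega_q^n\colon \sum_{i=1}^n x_i=0\}$. For $x\in\Omega_q^n$ and an integer $r$, $x^r=[x_1^r,\dots,x_n^r]$. Two vectors $x,y\in\Omega_q^n$ are called equivalent, $x\cong y$, if there exist a coordinate permutation $\tau\in S_n$, a scalar $\zeta\in\Omega_q$ and an integer $1\le r\le q-1$ coprime to $q$ such that $(\zeta\cdot\tau(x))^r=y$. For $x\in\Omega_q^n$ and $z\in\mathbb{Z}_q^n$, write $x^z=\prod_{k=1}^n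 x_k^{z_k}$; the Fourier transform of $g$ is $\widehat{g}(z)=\sum_{x\in\Omega_q^n}g(x)x^z$ for $z\in\mathbb{Z}_q^n$. *)

(* Defs.v *)
From mathcomp Require Import all_boot all_order all_algebra all_fingroup.
From mathcomp Require Import complex.
From mathcomp Require Import reals trigo.

Set Implicit Arguments.
Unset Strict Implicit.
Unset Printing Implicit Defensive.

Import Order.TTheory GRing.Theory Num.Theory.

Local Open Scope ring_scope.
Local Open Scope complex_scope.

Definition butson_hadamard (R : realType) (n q : nat) (H : 'M[R[i]]_n) : Prop :=
  (forall i j : 'I_n, q.-unity_root (H i j)) /\
  (forall i j : 'I_n, i != j -> \sum_(k < n) H i k * Num.conj (H j k) = 0).

(* exp(2 pi i / q), through Euler's formula *)
Definition zeta (R : realType) (q : nat) : R[i] :=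
  cos (2 * pi / q%:R) +i* sin (2 * pi / q%:R).

(* The finite type {1, zeta, ..., zeta^(q-1)}, as a subtype of R[i]: membership
   in the sequence is a boolean, so \val is injective. *)
Definition Omega (R : realType) (q : nat) : finType :=
  seq_sub [seq zeta R q ^+ k | k <- iota 0 q].

Definition coords (R : realType) (n q : nat) (x : 'rV[Omega R q]_n) :
  'rV[R[i]]_n := map_mx val x.

Definition ORT (R : realType) (n q : nat) : {set 'rV[Omega R q]_n} :=
  [set x | \sum_(k < n) coords x 0 k == 0].

Definition vpow (R : realType) (n : nat) (v : 'rV[R[i]]_n) (r : nat) :
  'rV[R[i]]_n := map_mx (fun c => c ^+ r) v.

(* For q = 1 no r is admissible, so the relation is empty there; Omega R 1 is
   a singleton. *)
Definition equivalent (R : realType) (n q : nat) (x y : 'rV[Omega R q]_n) :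
  Prop :=
  exists (tau : 'S_n) (c : Omega R q) (r : nat),
    [/\ (1 <= r <= q - 1)%N, coprime r q &
        vpow (val c *: col_perm tau (coords x)) r = coords y].

(* Z_q is represented by its residues 'I_q ('Z_q is wrong for q = 1); the
   exponent representative is immaterial as the coordinates are q-th roots of
   unity. *)
Definition vexp (R : realType) (n q : nat) (x : 'rV[Omega R q]_n)
  (z : 'rV['I_q]_n) : R[i] := \prod_(k < n) coords x 0 k ^+ z 0 k.

Definition fourier (R : realType) (n q : nat) (g : 'rV[Omega R q]_n -> R)
  (z : 'rV['I_q]_n) : R[i] :=
  \sum_(x : 'rV[Omega R q]_n) (g x)%:C * vexp x z.

(* Main.v *)
Require Import Defs.
From mathcomp Require Import all_boot all_order all_algebra all_fingroup.
From mathcomp Require Import all_field.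
From mathcomp Require Import complex.
From mathcomp Require Import reals trigo.
From mathcomp Require Import ring.

Set Implicit Arguments.
Unset Strict Implicit.
Unset Printing Implicit Defensive.

Import Order.TTheory GRing.Theory Num.Theory.

Local Open Scope ring_scope.
Local Open Scope complex_scope.

(* Consider all quotients c h_i / h_j of rows of H scaled by c in Omega_q,
   together with their images under coordinate permutations and powers u coprime
   to q. Up to normalisation, g(x) counts how often x occurs among these vectors.
   For i = j the quotient is constant; for i <> j it sums to 0, and this survives
   the u-th power because the cyclotomic polynomial is irreducible. The Fourier
   transform factors, for each permutation and each u, as a power sum over
   Omega_q times |P_1 + ... + P_n|^2, where P_i is a monomial in the entries of
   h_i. *)

(** * Cyclotomic polynomials and vanishing sums of roots of unity *)

(** Since ['X^q - 1] is the product of the ['Phi_d] over [d] dividing [q], some such ['Phi_d]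
    vanishes at [w]; then [w ^+ d = 1], and primitivity forces [d = q]. *)
Lemma root_Cyclotomic (F : fieldType) (q : nat) (w : F) :
  q.-primitive_root w -> root (map_poly intr 'Phi_q) w.
Proof.
move=> prim_w; have q_gt0 := prim_order_gt0 prim_w.
have rootXn d : (0 < d)%N ->
    (w ^+ d == 1) = has (fun e => root (map_poly intr 'Phi_e) w) (divisors d).
  move=> d_gt0.
  have := congr1 (map_poly (intr : int -> F)) (prod_Cyclotomic d_gt0).
  rewrite rmorphB rmorph1 rmorph_prod /= map_polyXn => /(congr1 (horner^~ w)).
  rewrite hornerD hornerN hornerXn hornerC horner_prod.
  move=> /esym/(congr1 (eq_op^~ 0)).
  by rewrite prodf_seq_eq0 subr_eq0.
have : w ^+ q == 1 by rewrite prim_expr_order.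
rewrite rootXn // => /hasP[d]; rewrite -dvdn_divisors // => dq rootd.
suff : w ^+ d == 1.
  rewrite -(prim_order_dvd prim_w) => qd.
  by rewrite (_ : q = d) //; apply/eqP; rewrite eqn_dvd qd.
have d_gt0 := dvdn_gt0 q_gt0 dq.
by rewrite rootXn //; apply/hasP; exists d => //; rewrite -dvdn_divisors.
Qed.

(* Irreducibility of the cyclotomic polynomial, which is only available for
   roots in algC: a common root in F yields a nonconstant gcd over Q, hence a
   common root in algC, which is again primitive. *)
Lemma Cyclotomic_dvdp (F : numFieldType) (q : nat) (w : F) (p : {poly rat}) :
  q.-primitive_root w -> root (map_poly ratr p) w ->
  map_poly intr 'Phi_q %| p.
Proof.
move=> prim_w pw0; have q_gt0 := prim_order_gt0 prim_w.
set Phi : {poly rat} := map_poly intr 'Phi_q.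
have PhiE (K : numFieldType) :
    map_poly ratr Phi = map_poly intr 'Phi_q :> {poly K}.
  by rewrite -map_poly_comp; apply: eq_map_poly => b; rewrite /= rmorph_int.
have : root (map_poly ratr (gcdp Phi p)) w.
  by rewrite gcdp_map root_gcd pw0 PhiE root_Cyclotomic.
have [/eqP/size_poly1P[c c0 ->]|szd _] := eqVneq (size (gcdp Phi p)) 1%N.
  by rewrite map_polyC rootC fmorph_eq0 (negPf c0).
have /closed_rootP[y] : size (map_poly (@ratr algC) (gcdp Phi p)) != 1%N.
  by rewrite size_map_poly.
rewrite gcdp_map root_gcd PhiE => /andP[Phiy py].
have [z prim_z] := C_prim_root_exists q_gt0.
have prim_y : q.-primitive_root y.
  by rewrite -(root_cyclotomic prim_z) -Cintr_Cyclotomic.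
have [r [Dr _] dvr] := minCpolyP y.
rewrite dvr in py; rewrite -(_ : r = Phi) //.
apply: (map_poly_inj (@ratr algC)).
by rewrite /= -Dr PhiE (minCpoly_cyclotomic prim_y) -Cintr_Cyclotomic.
Qed.

(** With [x i = zq ^+ a i], the polynomial summing the ['X^(a i)] vanishes at [zq], so ['Phi_q]
    divides it. It therefore vanishes at the primitive root [zq ^+ r] as well. *)
Lemma sum_unity_rootX (F : numFieldType) (q r : nat) (zq : F) (I : finType)
    (x : I -> F) :
  q.-primitive_root zq -> (forall i, x i ^+ q = 1) -> coprime r q ->
  \sum_i x i = 0 -> \sum_i x i ^+ r = 0.
Proof.
move=> prim_z xq co_r sum0.
have /fin_all_exists[a xE] i : exists a : 'I_q, x i = zq ^+ a.
  by have [a ->] := prim_rootP prim_z (xq i); exists a.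
pose p : {poly rat} := \sum_i 'X^(a i).
have hp y : (map_poly ratr p).[y] = \sum_i y ^+ a i :> F.
  rewrite rmorph_sum horner_sum; apply: eq_bigr => i _ /=.
  by rewrite map_polyXn hornerXn.
have /dvdpP[s ps] : map_poly intr 'Phi_q %| p.
  apply: (Cyclotomic_dvdp prim_z); rewrite /root hp.
  by rewrite -(eq_bigr _ (fun i _ => xE i)) sum0.
have -> : \sum_i x i ^+ r = \sum_i (zq ^+ r) ^+ a i.
  by apply: eq_bigr => i _; rewrite xE -!exprM mulnC.
rewrite -hp ps rmorphM hornerM /= -map_poly_comp.
rewrite (@eq_map_poly _ _ _ (intr : int -> F)); last first.
  by move=> b; rewrite /= rmorph_int.
rewrite [X in _ * X](_ : _ = 0) ?mulr0 //; apply/rootP/root_Cyclotomic.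
by rewrite prim_root_exp_coprime.
Qed.

(** * Roots of unity and the group of scalars *)

Lemma zetaX (R : realType) (q k : nat) :
  zeta R q ^+ k =
  cos (2 * pi / q%:R * k%:R) +i* sin (2 * pi / q%:R * k%:R).
Proof.
elim: k => [|k IHk]; first by rewrite mulr0 cos0 sin0 expr0.
rewrite exprS IHk /zeta; set t := 2 * pi / q%:R.
rewrite -natr1 mulrDr mulr1 [_ + t]addrC cosD sinD.
by apply/eqP; rewrite eq_complex /= eqxx addrC eqxx.
Qed.

Lemma zeta_prim_root (R : realType) (q : nat) :
  (0 < q)%N -> q.-primitive_root (zeta R q).
Proof.
move=> q_gt0; have q0 : q%:R != 0 :> R by rewrite pnatr_eq0 -lt0n.
apply/andP; split => //; apply/forallP => k; apply/eqP; rewrite unity_rootE.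
have [->|kq] := eqVneq k.+1 q.
  rewrite zetaX divfK // mulrC mulr_natr cos2pi sin2pi.
  by rewrite eq_complex /= !eqxx.
apply/negbTE; rewrite zetaX eq_complex /= negb_and; apply/orP; left.
(* Half the angle: [u] lies strictly between 0 and [pi], so [sin u > 0] and the double-angle formula
   gives [cos (u *+ 2) < 1]. *)
set u : R := pi / q%:R * k.+1%:R.
have -> : 2 * pi / q%:R * k.+1%:R = u *+ 2 by rewrite -[u *+ 2]mulr_natl /u !mulrA.
have u_gt0 : 0 < u by rewrite !mulr_gt0 ?pi_gt0 ?invr_gt0 ?ltr0n.
have u_ltpi : u < pi.
  rewrite /u -mulrA gtr_pMr ?pi_gt0 // mulrC ltr_pdivrMr ?ltr0n // mul1r.
  by rewrite ltr_nat ltn_neqAle kq ltn_ord.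
have su : 0 < sin u by rewrite sin_gt0_pi // u_gt0.
rewrite cos_mulr2n subr_eq -mulr2n eqrMn2r //= lt_eqF //.
rewrite -subr_gt0 -sin2cos2; exact: exprn_gt0.
Qed.

(** The Chinese remainder of 0 mod [r] and 1 mod [q] is a multiple of [r]; its cofactor is the
    inverse. *)
Lemma coprime_modn_inv (r q : nat) :
  coprime r q -> exists m, (r * m = 1 %[mod q])%N.
Proof.
move=> co_rq; have /dvdnP[m Dm] : (r %| chinese r q 0 1)%N.
  by rewrite /dvdn (chinese_modl co_rq) mod0n.
by exists m; rewrite mulnC -Dm (chinese_modr co_rq).
Qed.

Lemma unity_rootX_inj (F : pzSemiRingType) (q r : nat) (x y : F) :
  coprime r q -> x ^+ q = 1 -> y ^+ q = 1 -> x ^+ r = y ^+ r -> x = y.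
Proof.
move=> /coprime_modn_inv[m Dm] xq yq /(congr1 (fun t => t ^+ m)).
by rewrite -!exprM -(expr_mod _ xq) -(expr_mod _ yq) Dm !expr_mod.
Qed.

Lemma unity_root_conj (C : numClosedFieldType) (q : nat) (x : C) :
  (0 < q)%N -> x ^+ q = 1 -> Num.conj x = x^-1.
Proof.
move=> q_gt0 xq; have nx1 : `|x| = 1.
  by apply/eqP; rewrite -(pexpr_eq1 q_gt0) // -normrX xq normr1.
by rewrite invC_norm nx1 expr1n invr1 mul1r.
Qed.

Lemma OmegaX (R : realType) (q : nat) (c : Omega R q) : val c ^+ q = 1.
Proof.
have /mapP[k] := ssvalP c; rewrite mem_iota add0n => /andP[_ kq] Dk.
have q_gt0 : (0 < q)%N by apply: leq_trans kq.
by rewrite [val c]Dk exprAC (prim_expr_order (zeta_prim_root R q_gt0)) expr1n.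
Qed.

Lemma Omega_exists (R : realType) (q : nat) (w : R[i]) :
  (0 < q)%N -> w ^+ q = 1 -> exists c : Omega R q, val c = w.
Proof.
move=> q_gt0 wq; have [k ->] := prim_rootP (zeta_prim_root R q_gt0) wq.
have kP : zeta R q ^+ k \in [seq zeta R q ^+ k | k <- iota 0 q].
  by apply/mapP; exists (val k); rewrite // mem_iota ltn_ord.
by exists (SeqSub kP).
Qed.

Lemma card_Omega (R : realType) (q : nat) : (0 < q)%N -> #|Omega R q| = q.
Proof.
move=> q_gt0; rewrite card_seq_sub ?size_map ?size_iota //.
rewrite map_inj_in_uniq ?iota_uniq // => a b.
rewrite !mem_iota !add0n => /andP[_ aq] /andP[_ bq] /eqP.
by rewrite (eq_prim_root_expr (zeta_prim_root R q_gt0)) !modn_small // => /eqP.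
Qed.

(** If [zeta ^+ s = 1], every term is 1. Otherwise multiplication by [zeta] permutes the index set,
    so the sum is fixed by the factor [zeta ^+ s] and vanishes. *)
Lemma sum_OmegaX_ge0 (R : realType) (q s : nat) :
  (0 < q)%N -> 0 <= \sum_(c : Omega R q) val c ^+ s.
Proof.
move=> q_gt0; have prim_z := zeta_prim_root R q_gt0.
have [zs1|zs1] := eqVneq (zeta R q ^+ s) 1.
  apply: sumr_ge0 => c _.
  have [k ->] := prim_rootP prim_z (OmegaX c).
  by rewrite exprAC zs1 expr1n ler01.
have /fin_all_exists[f fE] (c : Omega R q) :
    exists d : Omega R q, val d = zeta R q * val c.
  by apply: Omega_exists; rewrite // exprMn OmegaX prim_expr_order ?mulr1.
have f_inj : injective f.
  move=> c d /(congr1 val); rewrite !fE => /mulfI/val_inj; apply.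
  apply: contra_eq_neq (prim_expr_order prim_z) => ->.
  by rewrite expr0n gtn_eqF // eq_sym oner_eq0.
set S := \sum_c _; suff /eqP : (1 - zeta R q ^+ s) * S = 0.
  by rewrite mulf_eq0 subr_eq0 eq_sym (negPf zs1) => /eqP->.
rewrite mulrBl mul1r {1}/S (reindex_inj f_inj) /= mulr_sumr -sumrB.
rewrite big1 // => c _.
by rewrite fE exprMn subrr.
Qed.

Lemma coords_inj (R : realType) (n q : nat) : injective (@coords R n q).
Proof.
move=> x y /rowP xy; apply/rowP => k; apply: val_inj.
by have := xy k; rewrite !mxE.
Qed.

(** * Quotients of rows: values, symmetries and counts *)

(* An element ((tau, u), (c, (i, j))) of [param] stands for the vector obtained
   from the quotient of the rows i and j of H by permuting its coordinates along
   tau, raising to the power u and scaling by c. *)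
Section RowQuotients.

Variables (R : realType) (n q : nat) (H : 'M[R[i]]_n).
Hypotheses (n_gt0 : (0 < n)%N) (q_gt0 : (0 < q)%N) (BH : butson_hadamard q H).

Definition param : finType :=
  (('S_n * 'I_q) * (Omega R q * ('I_n * 'I_n)))%type.

Definition admissible : {set param} :=
  setX (setX setT [set u : 'I_q | coprime u q]) setT.

Definition row_quotient (t : param) : 'rV[R[i]]_n :=
  let: ((tau, u), (c, (i, j))) := t in
  \row_k (val c * (H i (tau k) / H j (tau k)) ^+ u).

Lemma HX i j : H i j ^+ q = 1.
Proof. by apply/eqP; rewrite -unity_rootE; apply: BH.1. Qed.

Lemma HVX i j k : (H i k / H j k) ^+ q = 1.
Proof. by rewrite expr_div_n !HX divr1. Qed.

Lemma H_neq0 i j : H i j != 0.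
Proof.
apply: contra_eq_neq (HX i j) => ->.
by rewrite expr0n gtn_eqF // eq_sym oner_eq0.
Qed.

Lemma row_quotient_exists t :
  exists x : 'rV[Omega R q]_n, coords x = row_quotient t.
Proof.
case: t => [[tau u] [c [i j]]].
have /fin_all_exists[x xE] (k : 'I_n) :
    exists d : Omega R q, val d = val c * (H i (tau k) / H j (tau k)) ^+ u.
  by apply: Omega_exists; rewrite // exprMn OmegaX mul1r exprAC HVX expr1n.
by exists (\row_k x k); apply/rowP => k; rewrite !mxE xE.
Qed.

Lemma row_quotient_diag tau u c i :
  row_quotient ((tau, u), (c, (i, i))) = const_mx (val c).
Proof.
by apply/rowP => k; rewrite !mxE divff ?H_neq0 // expr1n mulr1.
Qed.

Lemma row_quotient_sum tau (u : 'I_q) c i j : coprime u q -> i != j ->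
  \sum_k row_quotient ((tau, u), (c, (i, j))) 0 k = 0.
Proof.
move=> co_u ij.
under eq_bigr do rewrite mxE.
rewrite -mulr_sumr; have -> : \sum_k (H i (tau k) / H j (tau k)) ^+ u =
    \sum_k (H i k / H j k) ^+ u.
  by rewrite [RHS](reindex_inj (@perm_inj _ tau)).
rewrite (sum_unity_rootX (zeta_prim_root R q_gt0)) ?mulr0 //.
  by move=> k; apply: HVX.
(* Conjugation inverts roots of unity, so for exponent 1 the sum of quotients is the inner product
   of rows [i] and [j]. *)
rewrite -[RHS](BH.2 i j ij); apply: eq_bigr => k _.
by rewrite (unity_root_conj q_gt0) ?HX.
Qed.

(** For [i != j] the coordinates sum to 0, whereas those of a constant vector sum to [n] times a
    nonzero scalar. *)
Lemma row_quotient_const tau (u : 'I_q) c i j a : coprime u q ->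
  row_quotient ((tau, u), (c, (i, j))) = const_mx (val (a : Omega R q)) ->
  (c == a) && (i == j).
Proof.
move=> co_u wa; have [ij|ij] := eqVneq i j.
  rewrite andbT; apply/eqP/val_inj.
  move: wa; rewrite -ij row_quotient_diag => /rowP/(_ (Ordinal n_gt0)).
  by rewrite !mxE.
have := row_quotient_sum tau c co_u ij; rewrite wa.
under eq_bigr do rewrite mxE.
rewrite sumr_const card_ord => /eqP; rewrite mulrn_eq0 gtn_eqF //= => /eqP a0.
have := OmegaX a; rewrite [val a]a0 expr0n gtn_eqF // => /eqP.
by rewrite eq_sym oner_eq0.
Qed.

(** An equivalence lifts to the parameters: it composes the permutations, multiplies [u] by [r]
    modulo [q] and sends [c] to [(d * c) ^+ r]. Hence equivalent vectors are hit by equally many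
    admissible parameters. *)
Lemma equivalent_reparam (x y : 'rV[Omega R q]_n) : equivalent x y ->
  exists2 f : param -> param, injective f & forall t,
    (f t \in admissible) = (t \in admissible) /\
    (row_quotient (f t) = coords y <-> row_quotient t = coords x).
Proof.
case=> tau [d [r [_ co_r yE]]].
have /fin_all_exists[h hE] (c : Omega R q) :
    exists e : Omega R q, val e = (val d * val c) ^+ r.
  by apply: Omega_exists; rewrite // exprAC exprMn !OmegaX mulr1 expr1n.
have dX (w : R[i]) : w ^+ q = 1 -> (val d * w) ^+ q = 1.
  by move=> wq; rewrite exprMn OmegaX wq mulr1.
have d0 : val d != 0 :> R[i].
  apply: contra_eq_neq (OmegaX d) => ->.
  by rewrite expr0n gtn_eqF // eq_sym oner_eq0.
have h_inj : injective h.
  move=> c e /(congr1 val); rewrite !hE => ce; apply/val_inj/(mulfI d0).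
  by apply: (unity_rootX_inj co_r _ _ ce); apply: dX; apply: OmegaX.
have [m mE] : exists m : 'I_q -> 'I_q, forall u, m u = (u * r %% q)%N :> nat.
  by exists (fun u => Ordinal (ltn_pmod (u * r) q_gt0)).
have m_inj : injective m.
  have [r' Dr'] := coprime_modn_inv co_r.
  move=> u v /(congr1 val) /=; rewrite !mE => /(congr1 (fun s => s * r' %% q)%N).
  rewrite !modnMml -!mulnA -!(modnMmr _ (r * r')) Dr' !modnMmr !muln1.
  by rewrite !modn_small // => /val_inj.
exists (fun t : param => let: ((s, u), (c, ij)) := t in
          (((tau * s)%g, m u), (h c, ij))).
  move=> [[s u] [c ij]] [[s' u'] [c' ij']] [].
  by move=> /mulgI-> /m_inj-> /h_inj-> ->.
move=> [[s u] [c [i j]]]; split.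
  by rewrite !inE /= mE coprime_modl coprimeMl co_r andbT.
have wE : row_quotient (((tau * s)%g, m u), (h c, (i, j))) =
    vpow (val d *: col_perm tau (row_quotient ((s, u), (c, (i, j))))) r.
  apply/rowP => k; rewrite !mxE hE permM mE.
  by rewrite (expr_mod _ (HVX _ _ _)) exprM -exprMn mulrA //.
rewrite wE -yE; split=> [/rowP xy|->] //.
(* To undo the equivalence, read the equation at the preimage of [k], cancel the [r]-th power, which
   is injective on [q]-th roots of unity, then cancel [d]. *)
apply/rowP => k; have := xy (tau^-1 k)%g.
rewrite /vpow !mxE permKV => /unity_rootX_inj-/(_ _ co_r) E.
apply: (mulfI d0); apply: E; apply: dX; last exact: OmegaX.
by rewrite exprMn OmegaX mul1r exprAC HVX expr1n.
Qed.

Lemma admissible_big (f : param -> R[i]) :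
  \sum_(t in admissible) f t =
  \sum_(p : 'S_n * 'I_q | coprime p.2 q)
    \sum_(c : Omega R q) \sum_(i < n) \sum_(j < n) f (p, (c, (i, j))).
Proof.
under [RHS]eq_bigr => p _.
  under eq_bigr do rewrite pair_bigA /=.
  rewrite pair_bigA /=; over.
rewrite pair_big /=.
apply: eq_big => [[[s u] [c [i j]]]|[[s u] [c [i j]]]] //.
by rewrite !inE /= !andbT.
Qed.

Lemma row_quotient_fourier_ge0 (z : 'rV['I_q]_n) :
  0 <= \sum_(t in admissible) \prod_(k < n) row_quotient t 0 k ^+ z 0 k.
Proof.
rewrite admissible_big; apply: sumr_ge0 => -[tau u] _ /=.
pose P i := \prod_(k < n) (H i (tau k) ^+ u) ^+ z 0 k.
(* Each coordinate contributes one factor of [c], and dividing by row [j] amounts to multiplying by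
   the conjugate of [P j]. *)
have PE c i j : \prod_(k < n) row_quotient ((tau, u), (c, (i, j))) 0 k ^+ z 0 k =
    val c ^+ (\sum_(k < n) z 0%R k) * (P i * Num.conj (P j)).
  rewrite rmorph_prod -big_split /= expr_sum -big_split /=.
  apply: eq_bigr => k _; rewrite mxE exprMn; congr (_ * _).
  rewrite !rmorphXn /= (unity_root_conj q_gt0) ?HX //.
  by rewrite -!exprMn.
under eq_bigr => c _.
  under eq_bigr => i _.
    under eq_bigr do rewrite PE.
    rewrite -mulr_sumr -mulr_sumr; over.
  rewrite -mulr_sumr; over.
rewrite -!mulr_suml -rmorph_sum mulr_ge0 ?mul_conjC_ge0 //.
exact: sum_OmegaX_ge0.
Qed.

Lemma card_admissible : #|admissible| =
  (n * q * (n * (#|{: 'S_n}| * #|[set u : 'I_q | coprime u q]|)))%N.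
Proof.
rewrite !cardsX !cardsT !card_prod card_Omega // !card_ord.
ring.
Qed.

(** The fibre consists of the parameters with [c = a] and [i = j], while the permutation and the
    coprime exponent remain free. *)
Lemma card_row_quotient_const (a : Omega R q) :
  #|[set t in admissible | row_quotient t == const_mx (val a)]| =
  (n * (#|{: 'S_n}| * #|[set u : 'I_q | coprime u q]|))%N.
Proof.
rewrite (_ : [set t in _ | _] = setX (setX setT [set u : 'I_q | coprime u q])
           (setX [set a] [set p : 'I_n * 'I_n | p.1 == p.2])); last first.
  apply/setP => -[[s u] [c [i j]]]; rewrite !inE /= andbT.
  case co_u: (coprime u q) => //=; apply/eqP/idP => [/row_quotient_const->//|].
  by move=> /andP[/eqP-> /eqP->]; apply: row_quotient_diag.
rewrite !cardsX cardsT cards1 mul1n mulnC; congr (_ * _)%N.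
rewrite -[RHS]card_ord.
rewrite -(card_imset _ (f := fun i : 'I_n => (i, i))) => [|i j []//].
apply: eq_card => -[i j]; rewrite !inE /=.
apply/eqP/imsetP => [->|[k _ [-> ->]]] //.
by exists j.
Qed.

End RowQuotients.

(* In the last clause, 0 <= w in R[i] means that w is real and nonnegative. *)
Theorem theorem2p2 (R : realType) (n q : nat) (hn : (1 <= n)%N)
  (hq : (1 <= q)%N)
  (hBH : exists H : 'M[R[i]]_n, butson_hadamard q H) :
  exists g : 'rV[Omega R q]_n -> R,
    (forall x : 'rV[Omega R q]_n, 0 <= g x) /\
    (forall a : Omega R q, g (const_mx a) = 1 / q%:R) /\
    (forall x : 'rV[Omega R q]_n,
       x \notin ORT R n q -> (forall a : Omega R q, x <> const_mx a) ->
       g x = 0) /\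
    (forall x y : 'rV[Omega R q]_n, equivalent x y -> g x = g y) /\
    \sum_(x : 'rV[Omega R q]_n) g x = n%:R /\
    (forall z : 'rV['I_q]_n, 0 <= fourier g z).
Proof.
have [H BH] := hBH.
(* [w] lifts the row quotients to vectors over [Omega R q]; within [A], its fibres are the sets
   [S x]. *)
have /fin_all_exists[w wE] := row_quotient_exists hq BH.
pose A := admissible R n q.
pose S (x : 'rV[Omega R q]_n) := [set t in A | row_quotient H t == coords x].
have SE x t : (t \in S x) = (t \in A) && (w t == x).
  by rewrite inE -wE (inj_eq (@coords_inj _ _ _)).
set M := (n * (#|{: 'S_n}| * #|[set u : 'I_q | coprime u q]|))%N.
have cardA : #|A| = (n * q * M)%N by apply: card_admissible.
have M_gt0 : (0 < M)%N.
  rewrite !muln_gt0 hn /=; apply/andP; split; first by apply/card_gt0P; exists 1%g.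
  (* The residue of 1, which is 0 when [q = 1] and still coprime to [q]. *)
  apply/card_gt0P; exists (Ordinal (ltn_pmod 1 hq)).
  by rewrite inE /= coprime_modl coprime1n.
have M0 : M%:R != 0 :> R by rewrite pnatr_eq0 -lt0n.
have q0 : q%:R != 0 :> R by rewrite pnatr_eq0 -lt0n.
(* As [A] has [n * q * M] elements and each constant vector has a fibre of size [M], dividing by
   [q * M] yields total mass [n] and the value [1 / q] on constants. *)
exists (fun x => #|S x|%:R / (q * M)%:R); do 5?split.
- by move=> x; rewrite divr_ge0.
- move=> a; rewrite (_ : #|S (const_mx a)| = M); last first.
    rewrite -[RHS](card_row_quotient_const hn hq BH a); apply: eq_card => t.
    by rewrite !inE /coords map_const_mx.
  by rewrite natrM invfM mulrCA divff // mulr1 mul1r.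
- move=> x x_ORT x_const; rewrite (_ : S x = set0) ?cards0 ?mul0r //.
  apply/setP => -[[s u] [c [i j]]]; rewrite [RHS]inE; apply/negP.
  rewrite inE => /andP[]; rewrite !inE /= andbT => co_u /eqP.
  rewrite -/(row_quotient H ((s, u), (c, (i, j)))) => tx.
  have [ij|ij] := eqVneq i j.
    apply: (x_const c); apply: coords_inj.
    by rewrite -tx -ij (row_quotient_diag hq BH) /coords map_const_mx.
  by move: x_ORT; rewrite inE -tx (row_quotient_sum hq BH) ?eqxx.
- move=> x y /(equivalent_reparam hq BH)[f f_inj fP]; congr (_%:R / _).
  (* The preimage of [S y] under the injection [f] is [S x]. *)
  rewrite -(card_preimset (S y) f_inj); apply: eq_card => t.
  rewrite [LHS]inE 2![RHS]inE; have [-> fE] := fP t; congr (_ && _).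
  by apply/eqP/eqP => /fE.
- rewrite -mulr_suml -natr_sum (_ : (\sum_x #|S x|)%N = #|A|); last first.
    rewrite -sum1_card (partition_big w xpredT) //=; apply: eq_bigr => x _.
    by rewrite -sum1_card; apply: eq_bigl => t; rewrite SE.
  by rewrite cardA -mulnA natrM mulfK // natrM mulf_neq0.
move=> z; rewrite /fourier.
(* Grouping the parameters by their vector turns the weighted sum over [x] into a plain sum over
   [A]. *)
have -> : \sum_x (#|S x|%:R / (q * M)%:R)%:C * vexp x z =
    ((q * M)%:R^-1)%:C * \sum_(t in A) vexp (w t) z.
  rewrite (partition_big w xpredT) //= mulr_sumr; apply: eq_bigr => x _.
  rewrite (eq_bigr (fun=> vexp x z)) => [|t /andP[_ /eqP->]] //.
  rewrite sumr_const (_ : #|_| = #|S x|); last first.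
    by apply: eq_card => t; rewrite SE.
  by rewrite rmorphM rmorph_nat mulrAC mulrC mulr_natl.
rewrite mulr_ge0 ?ler0c ?invr_ge0 //.
have := row_quotient_fourier_ge0 hq BH z.
by rewrite (eq_bigr (fun t => vexp (w t) z)) // => t _; rewrite /vexp wE.
Qed.
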